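(* Let $h>0$, let $p_1,p_2,p_3,p_4>0$ with $\sum_{l=1}^4 p_l=1$, and assume $|p_1-p_3|+|p_2-p_4|\neq 0$. Let $e\in h\mathbb{Z}^2$. Then the function $w\mapsto \mathbb{E}_e[\ell_\infty(w)]$ from $h\mathbb{Z}^2$ to $\mathbb{R}_+$ attains its maximum uniquely at $w=e$.
   Context: Let $h\mathbb{Z}^2=\{hz: z\in\mathbb{Z}^2\}$ and $e_1=(1,0)'$, $e_2=(0,1)'$, $e_3=-e_1$, $e_4=-e_2$ (the unsubscripted $e$ is a separate object, a point of $h\mathbb{Z}^2$). For $v\in h\mathbb{Z}^2$, $\mathbb{P}_v$ is the probability measure on the sequence space $(h\mathbb{Z}^2)^\infty$ under which the canonical coordinate sequence $(X_n)_{n\ge 0}$ is the Markov chain with $X_0=v$ a.s. and transition probabilities $\mathbb{P}_v[X_n=x+he_l\mid X_{n-1}=x]=p_l$, $l=1,\dots,4$, $n\geq 1$, $x\in h\mathbb{Z}^2$; $\mathbb{E}_v$ is the corresponding expectation. For $w\in h\mathbb{Z}^2$, $\ell_\infty(w)=\sum_{n=0}^\infty \delta_w(X_n)$, where $\delta_{v_1}(v_2)=1$ if $v_1=v_2$ and $0$ otherwise; that is, $\ell_\infty(w)$ is the total number of visits of the chain to $w$. *)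

(* Defs.v *)
From HB Require Import structures.
From mathcomp Require Import all_boot all_order all_algebra.
From mathcomp Require Import all_classical all_reals all_analysis.

Set Implicit Arguments.
Unset Strict Implicit.
Unset Printing Implicit Defensive.

Import Order.TTheory GRing.Theory Num.Theory.

Local Open Scope classical_set_scope.
Local Open Scope ring_scope.

Definition hZ2_set (R : realType) (h : R) : set 'cV[R]_2 :=
  [set h *: map_mx intr z | z in [set: 'cV[int]_2]].

Definition hZ2 (R : realType) (h : R) : Type := set_type (hZ2_set h).

HB.instance Definition _ (R : realType) (h : R) :=
  SubChoice.copy (hZ2 h) (set_type (hZ2_set h)).

Lemma hZ2_set0 (R : realType) (h : R) : (0 : 'cV[R]_2) \in hZ2_set h.
Proof. by apply/mem_set; exists 0 => //; rewrite map_mx0 scaler0. Qed.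

HB.instance Definition _ (R : realType) (h : R) :=
  isPointed.Build (hZ2 h) (Sub 0 (hZ2_set0 h)).

(* Indices are 0-based: [dir R l] is the direction written e_(l+1), with
   e_1 = (1,0)', e_2 = (0,1)', e_3 = - e_1, e_4 = - e_2. *)
Definition dir (R : realType) (l : 'I_4) : 'cV[R]_2 :=
  match val l with
  | 0%N => delta_mx 0 0
  | 1%N => delta_mx 1 0
  | 2%N => - delta_mx 0 0
  | _ => - delta_mx 1 0
  end.

(* hZ2 carries the discrete sigma-algebra: these sets generate the product
   sigma-algebra on sequences. *)
Definition coordinate_events (R : realType) (h : R) : set (set (nat -> hZ2 h)) :=
  [set A | exists (n : nat) (B : set (hZ2 h)), A = [set X | B (X n)]].

Definition seq_space (R : realType) (h : R) :=
  g_sigma_algebraType (@coordinate_events R h).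

Definition cond_prob d (T : measurableType d) (R : realType)
    (P : probability T R) (A B : set T) : R :=
  fine (P (A `&` B)) / fine (P B).

(* Conditional probabilities are only constrained when the conditioning event
   has nonzero probability. *)
Definition is_walk_law (R : realType) (h : R) (p : 'I_4 -> R) (v : hZ2 h)
    (P : probability (seq_space h) R) : Prop :=
  [/\ {ae P, forall X, X 0%N = v},
      forall (n : nat) (x : nat -> hZ2 h) (y : hZ2 h),
        P [set X | forall k, (k <= n)%N -> X k = x k] != 0%E ->
        cond_prob P [set X | X n.+1 = y]
                    [set X | forall k, (k <= n)%N -> X k = x k] =
        cond_prob P [set X | X n.+1 = y] [set X | X n = x n] &
      forall (n : nat) (x : hZ2 h) (l : 'I_4),
        P [set X | X n = x] != 0%E ->
        cond_prob P [set X | val (X n.+1) = val x + h *: dir R l]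
                    [set X | X n = x] = p l].

Definition total_visits (R : realType) (h : R) (w : hZ2 h) (X : seq_space h) :
    \bar R :=
  (\sum_(0 <= n <oo) ((X n == w)%:R)%:E)%E.

(* Integral rather than 'E_P, whose argument has to be real-valued: the number
   of visits may be infinite on some trajectories. *)
Definition expected_visits (R : realType) (h : R)
    (P : probability (seq_space h) R) (w : hZ2 h) : \bar R :=
  (\int[P]_X total_visits w X)%E.

(* Main.v *)
Require Import Defs.
From mathcomp Require Import all_boot all_order all_algebra.
From mathcomp Require Import all_classical all_reals all_analysis.
From mathcomp Require Import zify ring lra measurable_realfun.

Set Implicit Arguments.
Unset Strict Implicit.
Unset Printing Implicit Defensive.

Import Order.TTheory GRing.Theory Num.Theory.
Import numFieldNormedType.Exports.

Local Open Scope classical_set_scope.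
Local Open Scope ring_scope.

(** The law of X_n alone evolves by
      a_{n+1}(z) = sum_l p_l a_n(z - d_l),   a_0 = indicator of e,
    and the expected number of visits is G(z) = sum_n a_n(z), so everything
    can be read off this recursion.

    Finiteness comes from the drift.  With s = sqrt(p_1/p_3) and
    t = sqrt(p_2/p_4), the exponential V(x,y) = s^x t^y is an eigenfunction of
    the averaging operator, with eigenvalue
    2 sqrt(p_1 p_3) + 2 sqrt(p_2 p_4)
      = 1 - (sqrt p_1 - sqrt p_3)^2 - (sqrt p_2 - sqrt p_4)^2,
    which is < 1 exactly because the drift does not vanish
    ([drift_superharmonic]).  Comparison with V makes a_n(z) decay
    geometrically in n ([mass_le_superharmonic]).

    That e is a maximum follows by comparing partial sums G_n by induction:
    away from e, G_{n+1} is an average of values of G_n, all at most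
    G_n(e) <= G_{n+1}(e) ([series_mass_le]).

    Uniqueness is the strong maximum principle.  In the limit
    G(z) = [z = e] + sum_l p_l G(z - d_l).  If G(z) = G(e) for some z <> e, the
    value G(e) spreads from z to its neighbours ([occupation_max_step]), and,
    the plane lattice with one point removed being connected
    ([punctured_lattice_connected]), to all four neighbours of e.  The
    equation at e then reads G(e) = 1 + G(e), which is absurd. *)

(** * The maximum principle for occupation densities *)

(** The setting is a walk on an abelian group with finitely many steps, known
    only through the recursion for its one-time marginals. *)
Section OccupationDensity.

Context (R : realType) (A : zmodType) (k : nat) (p : 'I_k -> R) (d : 'I_k -> A).
Context (e : A) (a : nat -> A -> R).
Hypothesis p_gt0 : forall l, 0 < p l.
Hypothesis p_sum1 : \sum_(l < k) p l = 1.
Hypothesis a0 : forall z, a 0%N z = (z == e)%:R.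
Hypothesis aS : forall n z, a n.+1 z = \sum_(l < k) p l * a n (z - d l).

Lemma mass_ge0 n z : 0 <= a n z.
Proof.
elim: n z => [|n IH] z; first by rewrite a0 ler0n.
by rewrite aS sumr_ge0 // => l _; rewrite mulr_ge0 // ltW.
Qed.

(** Splitting off time 0 turns the recursion in time into an inhomogeneous
    harmonic equation in space, whose source is the starting point. *)
Lemma series_mass_rec n z :
  series (a^~ z) n.+1 =
  (z == e)%:R + \sum_(l < k) p l * series (a^~ (z - d l)) n.
Proof.
rewrite /series /= big_nat_recl //= a0; congr (_ + _).
rewrite (eq_bigr _ (fun i _ => aS i z)) exchange_big /=.
by apply: eq_bigr => l _; rewrite mulr_sumr.
Qed.

(** Away from the source the density up to time n+1 is an average of
    densities up to time n, so no maximum can arise there.  The finite horizon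
    turns this maximum principle into an induction on n; a direct argument on
    the limit would have to start from an attained supremum. *)
Lemma series_mass_le n z : series (a^~ z) n <= series (a^~ e) n.
Proof.
elim: n z => [|n IH] z; first by rewrite /series /= !big_geq.
have [->//|zNe] := eqVneq z e.
rewrite series_mass_rec (negbTE zNe) add0r.
apply: (@le_trans _ _ (series (a^~ e) n)).
  rewrite -[leRHS]mul1r -p_sum1 mulr_suml.
  by apply: ler_sum => l _; rewrite ler_pM2l.
by rewrite /series /= big_nat_recr //= lerDl mass_ge0.
Qed.

(** Since [V] only shrinks by [c] at each averaging, domination at time 0, where
    all mass is at [e], propagates with a factor [c] per step. *)
Lemma mass_le_superharmonic (V : A -> R) (c : R) :
  0 <= c -> (forall z, 0 < V z) ->
  (forall z, \sum_(l < k) p l * V (z - d l) <= c * V z) ->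
  forall n z, a n z <= V z / V e * c ^+ n.
Proof.
move=> c_ge0 V_gt0 Vc; elim=> [|n IH] z.
  rewrite a0 expr0 mulr1; case: eqVneq => [->|_]; first by rewrite divff ?gt_eqF.
  by rewrite divr_ge0 // ltW.
rewrite aS.
apply: (@le_trans _ _ (\sum_(l < k) p l * (V (z - d l) / V e * c ^+ n))).
  by apply: ler_sum => l _; rewrite ler_pM2l.
have -> : \sum_(l < k) p l * (V (z - d l) / V e * c ^+ n) =
   (\sum_(l < k) p l * V (z - d l)) * ((V e)^-1 * c ^+ n).
  by rewrite mulr_suml; apply: eq_bigr => l _; rewrite !mulrA.
have -> : V z / V e * c ^+ n.+1 = (c * V z) * ((V e)^-1 * c ^+ n).
  by rewrite exprS; ring.
by apply: ler_wpM2r => //; rewrite mulr_ge0 ?exprn_ge0 ?invr_ge0 // ltW.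
Qed.

Lemma series_mass_cvg (V : A -> R) (c : R) :
  0 <= c -> c < 1 -> (forall z, 0 < V z) ->
  (forall z, \sum_(l < k) p l * V (z - d l) <= c * V z) ->
  forall z, cvgn (series (a^~ z)).
Proof.
move=> c_ge0 c_lt1 V_gt0 Vc z.
apply: (@series_le_cvg _ _ (geometric (V z / V e) c)).
- by move=> n; exact: mass_ge0.
- by move=> n; rewrite /= mulr_ge0 ?exprn_ge0 // divr_ge0 // ltW.
- by move=> n; exact: mass_le_superharmonic.
- by apply: is_cvg_geometric_series; rewrite ger0_norm.
Qed.

Hypothesis a_cvg : forall z, cvgn (series (a^~ z)).

Lemma occupation_rec z :
  limn (series (a^~ z)) =
  (z == e)%:R + \sum_(l < k) p l * limn (series (a^~ (z - d l))).
Proof.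
apply/cvg_lim => //; rewrite -(cvg_shiftS (series _)) /=.
under eq_fun do rewrite series_mass_rec.
apply: cvgD; first exact: cvg_cst.
apply: cvg_big => [|l _]; first by move=> x; exact: add_continuous.
by apply: cvgMr; exact: a_cvg.
Qed.

Lemma occupation_le z : limn (series (a^~ z)) <= limn (series (a^~ e)).
Proof. by apply: ler_lim => //; apply: nearW => n; exact: series_mass_le. Qed.

(** An average of numbers that are at most [G e] can equal [G e] only if each
    of them does, every weight being positive. *)
Lemma occupation_max_step z l : z != e ->
  limn (series (a^~ z)) = limn (series (a^~ e)) ->
  limn (series (a^~ (z - d l))) = limn (series (a^~ e)).
Proof.
set G := fun z => limn (series (a^~ z)); rewrite -!/(G _) => zNe Gz.
have /psumr_eq0P : forall i, true -> 0 <= p i * (G e - G (z - d i)).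
  by move=> i _; rewrite mulr_ge0 ?(ltW (p_gt0 _)) // subr_ge0 occupation_le.
have -> : \sum_i p i * (G e - G (z - d i)) = 0.
  under eq_bigr do rewrite mulrBr.
  rewrite sumrB -mulr_suml p_sum1 mul1r -{1}Gz {1}/G occupation_rec.
  by rewrite (negbTE zNe) add0r subrr.
move=> /(_ erefl l isT) /eqP.
by rewrite mulf_eq0 gt_eqF //= subr_eq0 => /eqP.
Qed.

(** [conn] says that the group with [e] removed is connected enough for the
    maximal value to spread from any point to all the neighbours of [e]; there
    the unit source makes constancy impossible. *)
Lemma occupation_lt
    (conn : forall S : A -> Prop, (forall z l, z != e -> S z -> S (z - d l)) ->
      (exists2 z, z != e & S z) -> forall l, S (e - d l)) z :
  z != e -> limn (series (a^~ z)) < limn (series (a^~ e)).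
Proof.
move=> zNe; rewrite lt_neqAle occupation_le andbT; apply/eqP => Gz.
set M := limn (series (a^~ e)) in Gz.
have GM : forall l, limn (series (a^~ (e - d l))) = M.
  apply: (conn (fun z => limn (series (a^~ z)) = M)); last by exists z.
  by move=> y l yNe Gy; exact: occupation_max_step.
have : M = 1 + M.
  rewrite {1}/M occupation_rec eqxx; congr (_ + _).
  by under eq_bigr do rewrite GM; rewrite -mulr_suml p_sum1 mul1r.
by move=> ME; lra.
Qed.

End OccupationDensity.

(** * The square lattice *)

(** The integer counterpart of [dir], so that all the combinatorics happens in
    a group where equality and induction are elementary. *)
Definition int_dir (l : 'I_4) : 'cV[int]_2 :=
  match val l with
  | 0%N => delta_mx 0 0
  | 1%N => delta_mx 1 0
  | 2%N => - delta_mx 0 0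
  | _ => - delta_mx 1 0
  end.

Lemma map_int_dir (R : realType) l : map_mx intr (int_dir l) = dir R l.
Proof.
by case: l => -[|[|[|[|//]]]] ? /=; rewrite /int_dir /dir /= ?map_mxN map_delta_mx.
Qed.

Definition vec (i j : int) : 'cV[int]_2 := \col_r (if r == 0 then i else j).

Lemma vecE (z : 'cV[int]_2) : z = vec (z 0 0) (z 1 0).
Proof.
apply/colP => r; rewrite mxE.
case: (unliftP 0 r) => [s|] ->; rewrite ?(ord1 s) ?eqxx //.
by congr (z _ _); exact: val_inj.
Qed.

Lemma vec_inj i j i' j' : (vec i j == vec i' j') = (i == i') && (j == j').
Proof.
apply/eqP/andP => [/colP vv|[/eqP-> /eqP->]//].
by have := vv 0; have := vv 1; rewrite !mxE /= => -> ->.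
Qed.

Lemma vecB_int_dir i j :
  [/\ vec i j - int_dir 0 = vec (i - 1) j, vec i j - int_dir 1 = vec i (j - 1),
      vec i j - int_dir 2 = vec (i + 1) j & vec i j - int_dir 3 = vec i (j + 1)].
Proof.
by split; apply/colP => r; rewrite !mxE;
  case: r => -[|[|//]] ? //=; rewrite ?subr0 ?opprK ?addr0.
Qed.

Lemma int_neighbor_closed (Q : int -> Prop) :
  (forall i, Q i -> Q (i - 1) /\ Q (i + 1)) -> forall i j, Q i -> Q j.
Proof.
move=> Qs i j Qi; rewrite -(subrK i j).
elim/int_ind: (j - i) => [|n|n]; rewrite ?add0r // => /Qs [Q1 Q2].
- by move: Q2; congr Q; rewrite -addn1 PoszD; ring.
- by move: Q1; congr Q; rewrite -addn1 PoszD; ring.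
Qed.

(** Every row and every column that avoids [e] can be followed without
    interruption, and each point other than [e] lies on one.  The point
    (i0 + 1, j0 + 1) lies on both kinds, which lets all points be reached
    through it. *)
Lemma punctured_lattice_connected (e : 'cV[int]_2) (S : 'cV[int]_2 -> Prop) :
  (forall z l, z != e -> S z -> S (z - int_dir l)) ->
  (exists2 z, z != e & S z) -> forall l, S (e - int_dir l).
Proof.
rewrite (vecE e); move: (e 0 0) (e 1 0) => i0 j0 {e} Ss [z zNe Sz].
have Sv i j : vec i j != vec i0 j0 -> S (vec i j) ->
    [/\ S (vec (i - 1) j), S (vec i (j - 1)),
        S (vec (i + 1) j) & S (vec i (j + 1))].
  move=> ne sij; have [<- <- <- <-] := vecB_int_dir i j.
  by split; exact: Ss.
have row j : j != j0 -> forall i i', S (vec i j) -> S (vec i' j).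
  move=> jN; apply: (@int_neighbor_closed (fun i => S (vec i j))) => i.
  by case/Sv; rewrite // vec_inj (negbTE jN) andbF.
have col i : i != i0 -> forall j j', S (vec i j) -> S (vec i j').
  move=> iN; apply: (@int_neighbor_closed (fun j => S (vec i j))) => j.
  by case/Sv; rewrite // vec_inj (negbTE iN).
have i1N : i0 + 1 != i0 by lia.
have j1N : j0 + 1 != j0 by lia.
have S11 : S (vec (i0 + 1) (j0 + 1)).
  move: zNe Sz; rewrite (vecE z) vec_inj negb_and => /orP[N|N].
    by move=> /(col _ N _ (j0 + 1)); exact: row.
  by move=> /(row _ N (z 0 0) (i0 + 1)); exact: col.
have all i j : vec i j != vec i0 j0 -> S (vec i j).
  rewrite vec_inj negb_and => /orP[N|N].
    by apply: (col _ N (j0 + 1)); exact: row S11.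
  by apply: (row _ N (i0 + 1)); exact: col S11.
have [E0 E1 E2 E3] := vecB_int_dir i0 j0.
have cases l : [\/ l = 0, l = 1, l = 2 | l = 3 :> 'I_4].
  by case: l => -[|[|[|[|//]]]] ?;
    [apply: Or41 | apply: Or42 | apply: Or43 | apply: Or44]; exact: val_inj.
move=> l; case: (cases l) => ->; rewrite ?E0 ?E1 ?E2 ?E3;
  by apply: all; rewrite vec_inj; lia.
Qed.

(** The tilt s^x t^y is chosen so that it balances opposite steps:
    p_1 / s = p_3 s = sqrt(p_1 p_3), and likewise for t.  This minimises the
    growth factor of the exponentials, and the minimum is below 1 by the
    strict arithmetic-geometric inequality. *)
Lemma drift_superharmonic (R : realType) (p : 'I_4 -> R)
    (p_gt0 : forall l, 0 < p l) (p_sum1 : \sum_(l < 4) p l = 1)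
    (p_drift : `|p 0 - p 2| + `|p 1 - p 3| != 0) :
  exists (c : R) (V : 'cV[int]_2 -> R), [/\ 0 <= c, c < 1, forall z, 0 < V z &
    forall z, \sum_(l < 4) p l * V (z - int_dir l) <= c * V z].
Proof.
pose q l := Num.sqrt (p l).
have q_gt0 l : 0 < q l by rewrite sqrtr_gt0.
have q_neq0 l : q l != 0 by rewrite gt_eqF.
have pE l : p l = q l ^+ 2 by rewrite sqr_sqrtr // ltW.
pose s := q 0 / q 2; pose t := q 1 / q 3.
have s_gt0 : 0 < s by rewrite divr_gt0.
have t_gt0 : 0 < t by rewrite divr_gt0.
have s_neq0 : s != 0 by rewrite gt_eqF.
have t_neq0 : t != 0 by rewrite gt_eqF.
have sumE (F : 'I_4 -> R) : \sum_(l < 4) F l = F 0 + F 1 + F 2 + F 3.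
  rewrite !big_ord_recr big_ord0 /= add0r.
  by congr (F _ + F _ + F _ + F _); exact: val_inj.
exists (2 * (q 0 * q 2) + 2 * (q 1 * q 3)), (fun z => s ^ z 0 0 * t ^ z 1 0).
split.
- by rewrite addr_ge0 // mulr_ge0 // ltW // mulr_gt0.
- have : 0 < (q 0 - q 2) ^+ 2 + (q 1 - q 3) ^+ 2.
    rewrite lt_neqAle addr_ge0 ?sqr_ge0 // andbT eq_sym.
    apply: contra p_drift; rewrite paddr_eq0 ?sqr_ge0 // !sqrf_eq0 !subr_eq0.
    by move=> /andP[/eqP q02 /eqP q13]; rewrite !pE q02 q13 !subrr normr0 addr0.
  by move: p_sum1; rewrite sumE !pE => p1; lra.
- by move=> z; rewrite mulr_gt0 // exprz_gt0.
- move=> z; rewrite (vecE z) sumE.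
  move: (z 0 0) (z 1 0) => i j; have [-> -> -> ->] := vecB_int_dir i j.
  rewrite !mxE /= !expfzDr // !expr1z !(exprN1, invr_expz) !pE.
  rewrite le_eqVlt; apply/orP; left; apply/eqP.
  (* Only s and t themselves must be expanded, not the common factor s^i t^j. *)
  rewrite [s ^ i]lock [t ^ j]lock /s /t -?exprnN ?invrK.
  field.
  by rewrite !q_neq0.
Qed.

(** * The marginals of the walk *)

Section WalkLaw.

Context (R : realType) (h : R).
Hypothesis h_gt0 : 0 < h.

Definition site (z : 'cV[int]_2) : hZ2 h :=
  Sub (h *: map_mx intr z) (mem_set (imageT (fun z => h *: map_mx intr z) z)).

Lemma siteP (w : hZ2 h) : exists z, w = site z.
Proof. by have [z _ zw] := set_valP w; exists z; exact/val_inj/esym. Qed.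

Lemma site_inj : injective site.
Proof.
move=> z z' /(congr1 val) /= /(scalerI (lt0r_neq0 h_gt0)) /matrixP zz.
by apply/matrixP => i j; have := zz i j; rewrite !mxE => /intr_inj.
Qed.

Lemma siteB_dir z l x :
  (val (site z) == val (site x) + h *: dir R l) = (x == z - int_dir l).
Proof.
have -> : val (site x) + h *: dir R l = val (site (x + int_dir l)).
  by rewrite /= map_mxD scalerDr map_int_dir.
by rewrite val_eqE (inj_eq site_inj) eq_sym -subr_eq opprK.
Qed.

Lemma measurable_coordinate n (B : set (hZ2 h)) :
  measurable [set X : seq_space h | B (X n)].
Proof.
by apply: (@sub_sigma_algebra _ setT (@coordinate_events R h)); exists n, B.
Qed.

Lemma measurable_at n (x : hZ2 h) : measurable [set X : seq_space h | X n = x].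
Proof. exact: (measurable_coordinate n [set x]). Qed.

Lemma dir_neq (l l' : 'I_4) : l != l' -> dir R l != dir R l'.
Proof.
move=> ll; rewrite -!map_int_dir; apply: contra ll => /eqP /matrixP ll.
have {}ll i : int_dir l i 0 = int_dir l' i 0.
  by have := ll i 0; rewrite !mxE => /intr_inj.
by move: (ll 0) (ll 1); rewrite /int_dir; case: l {ll} => -[|[|[|[|//]]]] ?;
  case: l' => -[|[|[|[|//]]]] ?; rewrite !mxE.
Qed.

Context (p : 'I_4 -> R) (e : hZ2 h) (P : probability (seq_space h) R).
Hypothesis p_sum1 : \sum_(l < 4) p l = 1.
Hypothesis P_walk : is_walk_law p e P.

Definition site_mass n z : R := fine (P [set X | X n = site z]).

Lemma site_massE n z : P [set X | X n = site z] = (site_mass n z)%:E.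
Proof. by rewrite fineK // fin_num_measure //; exact: measurable_at. Qed.

Definition jump n x l : set (seq_space h) :=
  [set X | val (X n.+1) = val x + h *: dir R l] `&` [set X | X n = x].

Lemma measurable_jump n x l : measurable (jump n x l).
Proof.
apply: measurableI; last exact: measurable_at.
exact: (measurable_coordinate n.+1 [set y | val y = val x + h *: dir R l]).
Qed.

(** In product form the transition law also holds at sites of probability
    zero, where the conditional probability carries no information. *)
Lemma jump_probability n x l :
  P (jump n x l) = ((p l)%:E * P [set X | X n = x])%E.
Proof.
have mx := measurable_at n x.
have [P0|PN] := eqVneq (P [set X | X n = x]) 0%E.
  rewrite P0 mule0; apply: (subset_measure0 _ mx _ P0).
    exact: measurable_jump.
  exact: subIsetr.
case: P_walk => _ _ /(_ n x l PN); rewrite /cond_prob => <-.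
have f0 : fine (P [set X | X n = x]) != 0 by rewrite fine_eq0 // fin_num_measure.
rewrite -[X in (_ * X)%E]fineK ?fin_num_measure // -EFinM divfK // fineK //.
by rewrite fin_num_measure //; exact: measurable_jump.
Qed.

Definition bad_jump n : set (seq_space h) :=
  [set X | forall l, val (X n.+1) <> val (X n) + h *: dir R l].

(** The four prescribed jump probabilities out of a site already sum to 1, so
    from each site anything else is null; as the lattice is countable, the null
    sets can be united. *)
Lemma bad_jump_negligible n : P.-negligible (bad_jump n).
Proof.
pose U x := \big[setU/set0]_(l < 4) jump n x l.
have mU x : measurable (U x).
  by apply: bigsetU_measurable => l _; exact: measurable_jump.
have PU x : P (U x) = P [set X | X n = x].
  rewrite measure_semi_additive_ord //.
  - rewrite -[RHS]fineK; last by rewrite fin_num_measure //; exact: measurable_at.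
    rewrite -[X in X%:E]mul1r -p_sum1 mulr_suml -sumEFin.
    apply: eq_bigr => l _; rewrite EFinM fineK; first exact: jump_probability.
    by rewrite fin_num_measure //; exact: measurable_at.
  - by move=> l; exact: measurable_jump.
  - apply/trivIsetP => l l' _ _ ll; rewrite -subset0 => X [[/= Xl _] [/= Xl' _]].
    move: Xl'; rewrite Xl => /addrI /(scalerI (lt0r_neq0 h_gt0)) /eqP.
    by rewrite (negbTE (dir_neq ll)).
  - exact: mU.
pose W k := if unpickle k is Some z then
  [set X : seq_space h | X n = site z] `\` U (site z) else set0.
have bW : bad_jump n `<=` \bigcup_k W k.
  move=> X bX; have [z Xz] := siteP (X n).
  exists (pickle z) => //; rewrite /W pickleK; split => //.
  rewrite /U -bigcup_seq => -[l _ [Xl _]]; apply: (bX l).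
  by rewrite Xz; exact: Xl.
apply: (negligibleS bW); apply: negligible_bigcup => k; rewrite /W.
case: unpickle => [z|]; last exact: negligible_set0.
have mz := measurable_at n (site z).
apply/negligibleP; first exact: measurableD.
have UX : U (site z) `<=` [set X | X n = site z].
  by rewrite /U -bigcup_seq => X [l _ []].
rewrite measureD //; last by rewrite ltey_eq fin_num_measure.
by rewrite (setIidr UX) [X in (_ - X)%E]PU subee // fin_num_measure.
Qed.

Lemma site_mass0 z z0 : e = site z0 -> site_mass 0 z = (z == z0)%:R.
Proof.
move=> eE; case: P_walk => e_ae _ _; rewrite /site_mass.
have me := measurable_at 0 e.
have Pe : P (~` [set X | X 0%N = e]) = 0%E.
  by apply: measure_negligible => //; exact: measurableC.
case: eqVneq => [->|zN].
  rewrite -eE -[X in P X]setCK probability_setC ?Pe ?sube0 //.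
  exact: measurableC.
rewrite (subset_measure0 _ _ _ Pe) //.
- exact: measurable_at.
- exact: measurableC.
- by move=> X /= ->; rewrite eE => /site_inj /eqP; rewrite (negbTE zN).
Qed.

(** Up to a null set, reaching [z] at time n+1 means jumping there from one of
    its four neighbours. *)
Lemma site_massS n z :
  site_mass n.+1 z = \sum_(l < 4) p l * site_mass n (z - int_dir l).
Proof.
apply: EFin_inj; rewrite -site_massE -sumEFin.
under eq_bigr do rewrite EFinM -site_massE -jump_probability.
pose J l := jump n (site (z - int_dir l)) l.
have mJ l : measurable (J l) by exact: measurable_jump.
rewrite -(@measure_semi_additive_ord _ _ _ P _ J) //; last 2 first.
- apply/trivIsetP => l l' _ _ ll; rewrite -subset0 => X [[_ /= Xl] [_ /= Xl']].
  move: Xl'; rewrite Xl => /site_inj /addrI /oppr_inj ll'; move: (dir_neq ll).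
  by rewrite -!map_int_dir ll' eqxx.
- by apply: bigsetU_measurable.
set U := \big[_/_]_(_ < _) _.
have mU : measurable U by apply: bigsetU_measurable.
have mE := measurable_at n.+1 (site z).
rewrite (measureDI P mE mU).
have -> : [set X | X n.+1 = site z] `&` U = U.
  apply: setIidr; rewrite /U -bigcup_seq => X [l _ [Xl _]].
  by apply/val_inj; rewrite Xl; apply/esym/eqP; rewrite siteB_dir.
rewrite [X in (X + _)%E]measure_negligible ?add0e //; first exact: measurableD.
apply: negligibleS (bad_jump_negligible n) => X [/= Xz XU] l Xl; apply: XU.
rewrite /U -bigcup_seq; exists l => /=; first by rewrite mem_index_enum.
have [x Xx] := siteP (X n).
move/eqP: Xl; rewrite Xz Xx siteB_dir => /eqP xE.
by split; [apply/eqP; rewrite /= Xz siteB_dir | rewrite /= Xx xE].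
Qed.

(** Monotone convergence exchanges the expectation with the sum over time. *)
Lemma expected_visitsE z :
  expected_visits P (site z) = (\sum_(0 <= n <oo) (site_mass n z)%:E)%E.
Proof.
rewrite /expected_visits /total_visits.
have E n : (fun X : seq_space h => ((X n == site z)%:R)%:E : \bar R) =
    (fun X => (\1_[set X | X n = site z] X)%:E).
  apply/funext => X; rewrite indicE; congr ((_ %:R) %:E); congr nat_of_bool.
  by apply/eqP/idP => [?|/set_mem//]; exact/mem_set.
have mz n := measurable_at n (site z).
rewrite integral_nneseries //.
- apply: eq_eseriesr => n _; rewrite E integral_indic // setIT.
  exact: site_massE.
- move=> n; rewrite E; apply/measurable_EFinP; exact: measurable_indic.
Qed.

End WalkLaw.

(** * Expected numbers of visits *)

Lemma expected_visits_lim (R : realType) (h : R)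
    (P : probability (seq_space h) R) z :
  cvgn (series (site_mass P ^~ z)) ->
  expected_visits P (site h z) = (limn (series (site_mass P ^~ z)))%:E.
Proof.
move=> mc; rewrite expected_visitsE -EFin_lim //.
by congr (limn _); apply/funext => n /=; rewrite /series /= sumEFin.
Qed.

Theorem proposition2p1 (R : realType) (h : R) (h_gt0 : 0 < h)
    (p : 'I_4 -> R) (p_gt0 : forall l, 0 < p l) (p_sum1 : \sum_(l < 4) p l = 1)
    (p_drift : `|p 0 - p 2| + `|p 1 - p 3| != 0)
    (e : hZ2 h) (P : probability (seq_space h) R) (P_walk : is_walk_law p e P) :
  (forall w : hZ2 h, (0 <= expected_visits P w < +oo)%E) /\
  (forall w : hZ2 h, w <> e -> (expected_visits P w < expected_visits P e)%E).
Proof.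
have [z0 eE] := siteP e.
have m0 z : site_mass P 0 z = (z == z0)%:R := site_mass0 h_gt0 P_walk z eE.
have mS := site_massS h_gt0 p_sum1 P_walk.
have [c [V [c_ge0 c_lt1 V_gt0 Vc]]] := drift_superharmonic p_gt0 p_sum1 p_drift.
have m_cvg := series_mass_cvg p_gt0 m0 mS c_ge0 c_lt1 V_gt0 Vc.
split=> w; have [z ->] := siteP w.
  apply/andP; split; last by rewrite expected_visits_lim // ltry.
  by apply: integral_ge0 => X _; apply: nneseries_ge0 => n _ _; rewrite lee_fin.
rewrite eE !expected_visits_lim // lte_fin => zN.
apply: (occupation_lt p_gt0 p_sum1 m0 mS m_cvg).
  exact: punctured_lattice_connected.
by apply: contra_notN zN => /eqP ->.
Qed.
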